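(* Let $\{n_i\}_{i\in\mathbb{Z}_+}$ be a sequence of strictly increasing real numbers (that is, $n_i\in\mathbb{R}$ for $i\in\mathbb{Z}_+$ and $n_1<n_2<n_3<\cdots$), and let $m_1,\dots,m_l$ be distinct real numbers. Let $$\mathbb{R}^{\{n_i\}_{i\in\mathbb{Z}_+}}_{m_1,\dots,m_l}=\{\,n_i+m_j\sqrt{-1}\;:\; i\in\mathbb{Z}_+,\ j=1,\dots,l\,\}\subset\mathbb{C}.$$ Then for any $N\in\mathbb{N}$, the set $\mathbb{R}^{\{n_i\}_{i\in\mathbb{Z}_+}}_{m_1,\dots,m_l}\times\{0,\dots,N\}$ is a unique expansion set.
   Context: $\mathbb{Z}_+$ denotes the positive integers, $\mathbb{N}$ the nonnegative integers, and $\mathbb{C}^\times=\mathbb{C}\setminus\{0\}$. For $z\in\mathbb{C}^\times$, $\log z=\log|z|+i\arg z$ with $0\le\arg z<2\pi$, and $z^\alpha=e^{\alpha\log z}$ for $\alpha\in\mathbb{C}$. A subset $\mathcal{S}$ of $\mathbb{C}\times\mathbb{C}$ is called a unique expansion set if the absolute convergence to $0$ on some nonempty open subset of $\mathbb{C}^\times$ of any series $$\sum_{(\alpha,\beta)\in\mathcal{S}}a_{\alpha,\beta}\,z^\alpha(\log z)^\beta,\qquad a_{\alpha,\beta}\in\mathbb{C},$$ implies that $a_{\alpha,\beta}=0$ for all $(\alpha,\beta)\in\mathcal{S}$. *)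

(* Defs.v *)
From HB Require Import structures.
From mathcomp Require Import all_boot all_order all_algebra.
From mathcomp Require Import all_classical all_reals all_analysis.
From mathcomp Require Import complex.
From mathcomp.analysis.showcase Require Import summability.
From mathcomp Require Import ring lra.

Set Implicit Arguments.
Unset Strict Implicit.
Unset Printing Implicit Defensive.

Import Order.TTheory GRing.Theory Num.Theory.
Import numFieldNormedType.Exports.

Local Open Scope classical_set_scope.
Local Open Scope complex_scope.
Local Open Scope ring_scope.

Local Notation Re := complex.Re.
Local Notation Im := complex.Im.
Local Notation normc := ComplexField.Normc.normc.

Section ComplexLogarithm.
Variable R : realType.
Implicit Types z w alpha : R[i].

Definition cexp z : R[i] :=
  (expR (Re z) * cos (Im z)) +i* (expR (Re z) * sin (Im z)).

(* The argument in [0, 2 pi); see carg_ge0, carg_lt2pi and clogK. *)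
Definition carg z : R :=
  let t := acos (Re z / normc z) in if 0 <= Im z then t else 2 * pi - t.

Definition clog z : R[i] := ln (normc z) +i* carg z.

(* At z = 0 the value extends 0 ^ n for natural n (see cpow_nat); for other
   exponents it is arbitrary. *)
Definition cpow z alpha : R[i] :=
  if z == 0 then (alpha == 0)%:R else cexp (alpha * clog z).

Lemma normc_gt0 z : z != 0 -> 0 < normc z.
Proof.
move=> z0; rewrite lt_neqAle; apply/andP; split.
  by apply: contra_neq z0 => /esym/ComplexField.Normc.eq0_normc.
by case: z {z0} => a b /=; exact: sqrtr_ge0.
Qed.

Lemma sqr_normc_def z : normc z ^+ 2 = Re z ^+ 2 + Im z ^+ 2.
Proof. by case: z => a b /=; rewrite sqr_sqrtr// addr_ge0// sqr_ge0. Qed.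

Lemma Re_div_normc_itv z : z != 0 -> -1 <= Re z / normc z <= 1.
Proof.
move=> z0; have r0 := normc_gt0 z0; have := sqr_normc_def z.
move=> h; rewrite -ler_norml normrM normfV [`|normc z|]gtr0_norm//.
rewrite ler_pdivrMr// mul1r -[leRHS]gtr0_norm// -ler_sqr ?nnegrE// ?normr_ge0//.
by rewrite !real_normK ?num_real// h lerDl sqr_ge0.
Qed.

Lemma carg_ge0 z : z != 0 -> 0 <= carg z.
Proof.
move=> /Re_div_normc_itv h; rewrite /carg; case: ifP => _.
  exact: acos_ge0.
have := acos_lepi h; have := pi_ge0 R; lra.
Qed.

Lemma carg_lt2pi z : z != 0 -> carg z < 2 * pi.
Proof.
move=> z0; have h := Re_div_normc_itv z0; rewrite /carg; case: ifP => Iz.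
  have := acos_lepi h; have := pi_gt0 R; lra.
rewrite ltrBlDr ltrDl acos_gt0//; case/andP: h => -> h /=.
rewrite lt_neqAle h andbT; apply/negP => /eqP e.
have r0 := normc_gt0 z0; have := sqr_normc_def z.
have -> : Re z = normc z by rewrite -[RHS]mul1r -e mulfVK ?gt_eqF.
move=> E; have /eqP : Im z ^+ 2 = 0 by move: E; lra.
rewrite sqrf_eq0 => /eqP Iz0; by rewrite Iz0 lexx in Iz.
Qed.

Lemma clogK z : z != 0 -> cexp (clog z) = z.
Proof.
move=> z0; have h := Re_div_normc_itv z0; have r0 := normc_gt0 z0.
have rn0 : normc z != 0 by rewrite gt_eqF.
rewrite /cexp /clog /= lnK ?posrE//.
have s : normc z * Num.sqrt (1 - (Re z / normc z) ^+ 2) = `|Im z|.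
  rewrite -[X in X * _]gtr0_norm// -sqrtr_sqr -sqrtrM ?sqr_ge0//.
  rewrite -[RHS]sqrtr_sqr; congr Num.sqrt.
  by rewrite mulrBr mulr1 exprMn exprVn mulrCA mulfV ?sqrf_eq0// mulr1
             sqr_normc_def addrC addKr.
suff [-> ->] : normc z * cos (carg z) = Re z /\ normc z * sin (carg z) = Im z.
  by case: z {z0 h r0 rn0 s}.
rewrite /carg; case: ifP => Iz.
  by rewrite acosK// sin_acos// s ger0_norm// mulrC mulfVK.
have -> t : 2 * pi - t = - t + (pi *+ 2 : R) by ring.
rewrite cosD2pi sinD2pi cosN sinN acosK// mulrN sin_acos// s ltr0_norm ?opprK.
  by rewrite mulrC mulfVK.
by rewrite ltNge Iz.
Qed.

Lemma cexp0 : cexp 0 = 1.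
Proof. by rewrite /cexp /= expR0 cos0 sin0 mulr0 mul1r. Qed.

Lemma cexpD z w : cexp (z + w) = cexp z * cexp w.
Proof.
case: z w => [a b] [c d]; rewrite /cexp /= expRD cosD sinD.
by apply/eqP; rewrite eq_complex /=; apply/andP; split; apply/eqP; ring.
Qed.

Lemma cpow_nat z (n : nat) : cpow z n%:R = z ^+ n.
Proof.
rewrite /cpow; case: eqP => [->|/eqP z0]; first by rewrite expr0n pnatr_eq0.
elim: n => [|n IHn]; first by rewrite mul0r cexp0 expr0.
by rewrite -natr1 mulrDl mul1r cexpD IHn clogK// exprSr.
Qed.

End ComplexLogarithm.

Section UniqueExpansionSet.
Variable R : realType.

(* Unordered sum of f over D: R[i]^o carries the norm topology of the complex
   plane, and totally is the filter of finite sets ordered by inclusion. *)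
Definition abs_cvg_sum (T : choiceType) (D : set T) (f : T -> R[i])
    (s : R[i]) : Prop :=
  (\esum_(t in D) (normc (f t))%:E < +oo)%E /\
  partial_sum (patch (fun=> 0) D f) A @[A --> totally] --> (s : R[i]^o).

(* The value of (log z) ^ beta at z = 1, where log z = 0 and the power may be
   meaningless, does not affect this notion: the quantification over U covers
   U minus {1}. *)
Definition unique_expansion_set (S : set (R[i] * R[i])) : Prop :=
  forall (a : R[i] * R[i] -> R[i]) (U : set R[i]^o),
    open U -> U !=set0 -> ~ U 0 ->
    (forall z : R[i], U z ->
       abs_cvg_sum S (fun p => a p * cpow z p.1 * cpow (clog z) p.2) 0) ->
    forall p, S p -> a p = 0.

Definition exponent_set (n : nat -> R) (l : nat) (m : 'I_l -> R) : set R[i] :=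
  [set n i +i* m j | i in [set: nat] & j in [set: 'I_l]].

End UniqueExpansionSet.

(* Main.v *)
Require Import Defs.
From mathcomp Require Import all_boot all_order all_algebra.
From mathcomp Require Import all_classical all_reals all_analysis.
From mathcomp Require Import complex finmap.
From mathcomp.analysis.showcase Require Import summability.
From mathcomp Require Import ring lra.

(** With w = log z the series reads sum_i E_i(w), where
    E_i(w) = sum_(j, k) a_ijk exp ((n_i + m_j sqrt(-1)) w) w ^ k gathers the
    finitely many terms whose exponent has real part n_i.

    Along a ray arg z = y, the variable w = x + y sqrt(-1) runs through a
    horizontal line.  Because the n_i are bounded below, absolute convergence at
    one abscissa x1 entails absolute convergence, with bounds uniform on
    compact sets, on the whole half-line x <= x1.  The sum is therefore analytic
    there, and being 0 on a segment it is 0 on the half-line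
    (vanishing_half_line).  As x tends to -oo the block E_0 dominates, since the
    other n_i are at least n_1 > n_0: exp (- n_0 w) E_0(w), an exponential
    polynomial with the distinct purely imaginary frequencies m_j sqrt(-1),
    tends to 0, which forces its coefficients to be 0
    (leading_coefficient_eq0).  Removing E_0 leaves a series of the same kind,
    and induction on i concludes (coefficients_eq0).

    The analytic continuation is carried out on the partial sums F_I.  If the
    Taylor remainders of all the F_I satisfy the same Cauchy estimates at a
    point, and F_I tends to 0 on a short segment, then each Taylor coefficient
    of F_I tends to 0 as I grows, hence so does F_I as far as the estimates
    reach (vanishing_expandable).  The estimates themselves come from the Taylor
    formula for the exponential function (exp_remainder_le).

    The exponential polynomial is sampled at w_q = w_0 - q s with s so small
    that the unimodular numbers exp (- m_j s sqrt(-1)) are distinct.  Its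
    coefficients are found one power of w at a time (exp_poly_vanishing), each
    trigonometric sum being resolved by a polynomial in the shift operator
    (trig_sum_vanishing). *)

Set Implicit Arguments.
Unset Strict Implicit.
Unset Printing Implicit Defensive.

Import Order.TTheory GRing.Theory Num.Theory.
Import numFieldNormedType.Exports.

Local Open Scope classical_set_scope.
Local Open Scope complex_scope.
Local Open Scope ring_scope.

Local Notation Re := complex.Re.
Local Notation Im := complex.Im.
Local Notation normc := ComplexField.Normc.normc.
Local Notation normcM := ComplexField.Normc.normcM.
Local Notation normc0 := ComplexField.Normc.normc0.

(** * The modulus and the exponential *)

Section Modulus.
Variable R : realType.
Implicit Types z w : R[i].

Lemma normc_ge0 z : 0 <= normc z.
Proof. by case: z => a b /=; exact: sqrtr_ge0. Qed.

Lemma normcN z : normc (- z) = normc z.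
Proof. exact: complex.normcN. Qed.

Lemma normcD z w : normc (z + w) <= normc z + normc w.
Proof. exact: le_normcD. Qed.

Lemma normcB z w : normc (z - w) <= normc z + normc w.
Proof. by rewrite (le_trans (normcD _ _))// normcN. Qed.

Lemma normcX z k : normc (z ^+ k) = normc z ^+ k.
Proof.
elim: k => [|k IH]; first by rewrite !expr0 ComplexField.Normc.normc1.
by rewrite !exprS normcM IH.
Qed.

Lemma normc_sum I (s : seq I) (P : pred I) (f : I -> R[i]) :
  normc (\sum_(i <- s | P i) f i) <= \sum_(i <- s | P i) normc (f i).
Proof.
elim/big_rec2: _ => [|i y x _ h]; first by rewrite normc0.
by rewrite (le_trans (normcD _ _))// lerD2l.
Qed.

Lemma normc_real (x : R) : normc x%:C = `|x|.
Proof. by rewrite /normc/= expr0n addr0 sqrtr_sqr. Qed.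

Lemma normc_le_ReIm z : normc z <= `|Re z| + `|Im z|.
Proof.
rewrite -ler_sqr ?nnegrE ?normc_ge0 ?addr_ge0//.
rewrite sqr_normc_def -(real_normK (num_real (Re z))).
rewrite -(real_normK (num_real (Im z))) sqrrD lerD2r lerDl.
by rewrite mulrn_wge0// mulr_ge0.
Qed.

Lemma normc_cexp z : normc (cexp z) = expR (Re z).
Proof.
rewrite /cexp /= !exprMn -mulrDr cos2Dsin2 mulr1 sqrtr_sqr.
by rewrite ger0_norm// expR_ge0.
Qed.

Lemma cexp_neq0 z : cexp z != 0.
Proof.
apply/eqP => /(congr1 (fun w : R[i] => normc w)); rewrite normc_cexp normc0 => /eqP.
by rewrite gt_eqF// expR_gt0.
Qed.

Lemma cexpMn z k : cexp (z *+ k) = cexp z ^+ k.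
Proof.
elim: k => [|k IH]; first by rewrite mulr0n cexp0 expr0.
by rewrite mulrS cexpD IH exprS.
Qed.

End Modulus.

(** * Taylor formula for the exponential along a line *)

Section Taylor.
Variable R : realType.

(** Differentiating real and imaginary parts separately keeps the
    analysis on the real line, where the monotonicity test is available. *)
Definition is_cderive (f : R -> R[i]) (t : R) (d : R[i]) :=
  is_derive t 1 (fun x => Re (f x)) (Re d) /\
  is_derive t 1 (fun x => Im (f x)) (Im d).

Lemma is_cderive_eq f t d d' : is_cderive f t d -> d = d' -> is_cderive f t d'.
Proof. by move=> + <-. Qed.

Lemma is_cderiveB f g t d e :
  is_cderive f t d -> is_cderive g t e ->
  is_cderive (fun x => f x - g x) t (d - e).
Proof.
move=> [f1 f2] [g1 g2]; split.
  have -> : (fun x => Re (f x - g x)) =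
            (fun x => Re (f x)) \- (fun x => Re (g x)).
    by apply/funext => x; rewrite raddfB.
  by rewrite raddfB; exact: is_deriveB.
have -> : (fun x => Im (f x - g x)) = (fun x => Im (f x)) \- (fun x => Im (g x)).
  by apply/funext => x; rewrite raddfB.
by rewrite raddfB; exact: is_deriveB.
Qed.

Lemma is_cderiveD f g t d e :
  is_cderive f t d -> is_cderive g t e ->
  is_cderive (fun x => f x + g x) t (d + e).
Proof.
move=> [f1 f2] [g1 g2]; split.
  have -> : (fun x => Re (f x + g x)) =
            (fun x => Re (f x)) \+ (fun x => Re (g x)).
    by apply/funext => x; rewrite raddfD.
  by rewrite raddfD; exact: is_deriveD.
have -> : (fun x => Im (f x + g x)) = (fun x => Im (f x)) \+ (fun x => Im (g x)).
  by apply/funext => x; rewrite raddfD.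
by rewrite raddfD; exact: is_deriveD.
Qed.

Lemma is_derive_mulfun (f g : R -> R) (t f' g' : R) :
  is_derive t 1 f f' -> is_derive t 1 g g' ->
  is_derive t 1 (fun x => f x * g x) (f' * g t + f t * g').
Proof.
move=> df dg; apply: (is_derive_eq (is_deriveM df dg)).
by rewrite /GRing.scale /=; ring.
Qed.

Lemma is_cderive_cexp mu t :
  is_cderive (fun x => cexp (mu * x%:C)) t (mu * cexp (mu * t%:C)).
Proof.
case: mu => a b; have lin c : is_derive t 1 (fun x : R => c * x) c.
  have := @is_deriveZ R R R id c t 1 1 (is_derive_id _ _).
  by rewrite /GRing.scale /= mulr1.
have de : is_derive t 1 (fun x => expR (a * x)) (expR (a * t) * a).
  exact: (is_derive1_comp (is_derive_expR _) (lin a)).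
have dc : is_derive t 1 (fun x => cos (b * x)) (- sin (b * t) * b).
  exact: (is_derive1_comp (is_derive_cos _) (lin b)).
have ds : is_derive t 1 (fun x => sin (b * x)) (cos (b * t) * b).
  exact: (is_derive1_comp (is_derive_sin _) (lin b)).
rewrite /is_cderive /cexp /=.
have E x : (a * x - b * 0 = a * x) * (a * 0 + b * x = b * x).
  by rewrite !mulr0 subr0 add0r.
split; under eq_fun do rewrite !E; rewrite !E.
  by apply: (is_derive_eq (is_derive_mulfun de dc)); ring.
by apply: (is_derive_eq (is_derive_mulfun de ds)); ring.
Qed.

Lemma is_derive_monomial (c : R) k (t : R) :
  is_derive t 1 (fun x => c * x ^+ k) (c * (k%:R * t ^+ k.-1)).
Proof.
have H := is_deriveZ c (is_deriveX k (is_derive_id t (1 : R))).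
have -> : (fun x => c * x ^+ k) = c \*: (id : R -> R) ^+ k.
  by apply/funext => x /=; rewrite exprfctE.
by apply: (is_derive_eq H); rewrite /GRing.scale /= mulr1.
Qed.

Lemma is_cderive_monomial (c : R[i]) k t :
  is_cderive (fun x => c * x%:C ^+ k) t (c * k%:R * t%:C ^+ k.-1).
Proof.
case: c => a b; have mon c : is_derive t 1 (fun x : R => c * x ^+ k)
    (c * (k%:R * t ^+ k.-1)).
  exact: is_derive_monomial.
have E x : (a +i* b) * x%:C ^+ k = (a * x ^+ k) +i* (b * x ^+ k).
  by rewrite -rmorphXn/=; apply/eqP; rewrite eq_complex/= !mulr0 subr0 add0r !eqxx.
have E' : (a +i* b) * k%:R * t%:C ^+ k.-1 =
    (a * (k%:R * t ^+ k.-1)) +i* (b * (k%:R * t ^+ k.-1)).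
  rewrite -mulrA -(rmorph_nat (real_complex R)) -rmorphXn -rmorphM/=.
  by apply/eqP; rewrite eq_complex/= !mulr0 subr0 add0r !eqxx.
rewrite E' /is_cderive/=; split.
  by under eq_fun do rewrite E /=; exact: mon.
by under eq_fun do rewrite E /=; exact: mon.
Qed.

Lemma is_cderive_poly (c : nat -> R[i]) n t :
  is_cderive (fun x => \sum_(r < n) c r * x%:C ^+ r) t
    (\sum_(r < n) c r * r%:R * t%:C ^+ r.-1).
Proof.
elim: n => [|n IH].
  rewrite big_ord0; split; under eq_fun do rewrite big_ord0 /=;
  exact: is_derive_cst.
rewrite big_ord_recr /=; under eq_fun do rewrite big_ord_recr /=.
exact: (is_cderiveD IH (is_cderive_monomial _ _ _)).
Qed.

Lemma le_of_derive (f g f' g' : R -> R) (rho : R) :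
  (forall x : R, is_derive x 1 f (f' x)) -> (forall x : R, is_derive x 1 g (g' x)) ->
  (forall x, 0 <= x <= rho -> f' x <= g' x) -> f 0 = g 0 ->
  forall t, 0 <= t <= rho -> f t <= g t.
Proof.
move=> df dg h e t /andP[t0 tr].
have D (x : R) : is_derive x 1 (g \- f) (g' x - f' x) by exact: is_deriveB.
have : (g \- f) 0 <= (g \- f) t.
  apply: (@ger0_derive1_ndecr R (g \- f) 0 rho) => //.
  - move=> x; rewrite in_itv/= => /andP[x0 xr].
    by rewrite derive1E (@derive_val _ _ _ _ _ _ _ (D x)) subr_ge0 h// !ltW.
  - apply: derivable_within_continuous => x _.
    exact: (@ex_derive _ _ _ _ _ _ _ (D x)).
by rewrite /= e subrr subr_ge0.
Qed.

Definition exp_remainder (mu : R[i]) n (t : R) : R[i] :=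
  cexp (mu * t%:C) - \sum_(r < n) mu ^+ r / r`!%:R * t%:C ^+ r.

Lemma is_cderive_exp_remainder mu n t :
  is_cderive (exp_remainder mu n.+1) t (mu * exp_remainder mu n t).
Proof.
apply: (is_cderive_eq
  (is_cderiveB (is_cderive_cexp mu t)
    (is_cderive_poly (fun r => mu ^+ r / r`!%:R) n.+1 t))).
rewrite /exp_remainder mulrBr; congr (_ - _).
rewrite big_ord_recl /= mulr0 mul0r add0r mulr_sumr; apply: eq_bigr => r _.
rewrite /bump /= add1n factS natrM exprS.
have f1 : r`!%:R != 0 :> R[i] by rewrite pnatr_eq0 -lt0n fact_gt0.
have f2 : r.+1%:R != 0 :> R[i] by rewrite pnatr_eq0.
rewrite add0n invfM; set u := t%:C ^+ r.
by field; rewrite f1 nat1r f2.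
Qed.

(** The remainder of order n + 1 has derivative mu times the remainder of
    order n and vanishes at 0, so the bound follows by integrating n times;
    the factor 2 pays for bounding the two components separately. *)
Lemma exp_remainder_le mu L rho n t :
  `|Re mu| <= L -> `|Im mu| <= L -> 0 <= t <= rho ->
  `|Re (exp_remainder mu n t)| <=
     expR (L * rho) * ((2 * L) ^+ n / n`!%:R * t ^+ n) /\
  `|Im (exp_remainder mu n t)| <=
     expR (L * rho) * ((2 * L) ^+ n / n`!%:R * t ^+ n).
Proof.
move=> reL imL; have L0 : 0 <= L by exact: le_trans reL.
elim: n t => [|n IH] t trho.
  have /andP[t0 tr] := trho.
  have h : normc (exp_remainder mu 0 t) <= expR (L * rho).
    rewrite /exp_remainder big_ord0 subr0 normc_cexp ler_expR.
    case: mu reL imL => a b /= reL imL; rewrite mulr0 subr0.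
    by rewrite (le_trans (ler_norm _))// normrM (ger0_norm t0) ler_pM.
  rewrite !expr0 fact0 !mulr1 invr1 !mulr1.
  move: h; case: (exp_remainder mu 0 t) => a b /= h.
  have aux (x y : R) : `|x| <= Num.sqrt (x ^+ 2 + y ^+ 2).
    by rewrite -[leLHS]sqrtr_sqr ler_sqrt ?addr_ge0 ?sqr_ge0// lerDl sqr_ge0.
  by split; apply: le_trans h; rewrite ?aux// addrC aux.
have n1 : n.+1%:R != 0 :> R by rewrite pnatr_eq0.
have nf : n`!%:R != 0 :> R by rewrite pnatr_eq0 -lt0n fact_gt0.
set C := expR (L * rho).
pose g := fun x : R => C * ((2 * L) ^+ n.+1 / n.+1`!%:R * x ^+ n.+1).
pose g' := fun x : R => (2 * L) * (C * ((2 * L) ^+ n / n`!%:R * x ^+ n)).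
have dg (x : R) : is_derive x 1 g (g' x).
  have -> : g = (fun y : R => C * ((2 * L) ^+ n.+1 / n.+1`!%:R) * y ^+ n.+1).
    by apply/funext => y; rewrite /g !mulrA.
  apply: (is_derive_eq (is_derive_monomial _ _ _)).
  by rewrite /g' /id factS natrM exprS; field; rewrite nf nat1r n1.
have g0 : g 0 = 0 by rewrite /g expr0n /= !mulr0.
have bound (p q : R) (z : R[i]) (x : R) : `|p| <= L -> `|q| <= L ->
    `|Re z| <= C * ((2 * L) ^+ n / n`!%:R * x ^+ n) ->
    `|Im z| <= C * ((2 * L) ^+ n / n`!%:R * x ^+ n) ->
    `|p * Re z + q * Im z| <= g' x.
  move=> pL qL zr zi; rewrite (le_trans (ler_normD _ _))//.
  rewrite /g' -mulrA mulr_natl mulr2n.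
  by rewrite !normrM lerD// ler_pM.
have e0 : exp_remainder mu n.+1 0 = 0.
  rewrite /exp_remainder mulr0 cexp0 big_ord_recl /= expr0 expr0 fact0 divr1.
  rewrite mulr1 big1 ?addr0 ?subrr// => i _.
  by rewrite expr0n /= mulr0.
have key (f f' : R -> R) : (forall x : R, is_derive x 1 f (f' x)) -> f 0 = 0 ->
    (forall x, 0 <= x <= rho -> `|f' x| <= g' x) -> `|f t| <= g t.
  move=> df f0 h; rewrite ler_norml; apply/andP; split.
    have dN (x : R) : is_derive x 1 (\- g) (- g' x) by exact: is_deriveN.
    apply: (@le_of_derive (\- g) f (\- g') f' rho dN df) => //=.
      by move=> x /h; rewrite ler_norml => /andP[].
    by rewrite f0 g0 oppr0.
  apply: (@le_of_derive f g f' g' rho df dg) => //=.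
    by move=> x /h; rewrite ler_norml => /andP[].
  by rewrite f0 g0.
have D x := is_cderive_exp_remainder mu n x.
split.
  apply: (key (fun x => Re (exp_remainder mu n.+1 x)) _ (fun x => (D x).1)).
    by rewrite e0.
  move=> x xr; have [b1 b2] := IH x xr.
  have -> : Re (mu * exp_remainder mu n x) =
      Re mu * Re (exp_remainder mu n x) + (- Im mu) * Im (exp_remainder mu n x).
    case: mu {reL imL IH e0 D b1 b2} (exp_remainder _ _ _) => a b [c d] /=.
    by rewrite mulNr.
  by apply: bound; rewrite ?normrN.
apply: (key (fun x => Im (exp_remainder mu n.+1 x)) _ (fun x => (D x).2)).
  by rewrite e0.
move=> x xr; have [b1 b2] := IH x xr.
have -> : Im (mu * exp_remainder mu n x) =
    Im mu * Re (exp_remainder mu n x) + Re mu * Im (exp_remainder mu n x).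
  case: mu {reL imL IH e0 D b1 b2} (exp_remainder _ _ _) => a b [c d] /=.
  by rewrite addrC.
exact: bound.
Qed.

End Taylor.

(** * Null sequences of complex numbers *)

Section Vanishing.
Variable R : realType.
Implicit Types u v : nat -> R[i].

Definition vanishing u :=
  forall e : R, 0 < e -> \forall I \near \oo, normc (u I) <= e.

Lemma vanishing_cst0 : vanishing (fun=> 0).
Proof. by move=> e e0; near=> I; rewrite normc0 ltW. Unshelve. all: by end_near. Qed.

Lemma vanishing_cst (c : R[i]) : vanishing (fun=> c) -> c = 0.
Proof.
move=> h; apply: ComplexField.Normc.eq0_normc; apply/eqP.
rewrite eq_le normc_ge0 andbT; apply/ler_addgt0Pl => e e0; rewrite addr0.
by have [I _ /(_ I (leqnn _))] := h e e0.
Qed.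

Lemma vanishingD u v :
  vanishing u -> vanishing v -> vanishing (fun I => u I + v I).
Proof.
move=> hu hv e e0; have e2 : 0 < e / 2 by rewrite divr_gt0.
near=> I; rewrite (le_trans (normcD _ _))// [leRHS]splitr lerD//; near: I.
  exact: hu.
exact: hv.
Unshelve. all: by end_near. Qed.

Lemma vanishingN u : vanishing u -> vanishing (fun I => - u I).
Proof. by move=> h e e0; under eq_near do rewrite normcN; exact: h. Qed.

Lemma vanishingB u v :
  vanishing u -> vanishing v -> vanishing (fun I => u I - v I).
Proof. by move=> hu hv; apply: vanishingD => //; exact: vanishingN. Qed.

Lemma vanishingM_bounded (B : R) u v :
  (forall I, normc (v I) <= B) -> vanishing u -> vanishing (fun I => v I * u I).
Proof.
move=> vB hu e e0; have B0 : 0 < B + 1.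
  by rewrite ltr_wpDl// (le_trans (normc_ge0 (v 0%N))).
have e1 : 0 < e / (B + 1) by rewrite divr_gt0.
near=> I; rewrite normcM.
rewrite (@le_trans _ _ ((B + 1) * (e / (B + 1))))//; last first.
  by rewrite mulrC divfK// gt_eqF.
rewrite ler_pM ?normc_ge0//; last by near: I; exact: hu.
by rewrite (le_trans (vB I))// lerDl.
Unshelve. all: by end_near. Qed.

Lemma vanishingZ (c : R[i]) u : vanishing u -> vanishing (fun I => c * u I).
Proof. exact: (@vanishingM_bounded (normc c)). Qed.

Lemma vanishing_sum (T : Type) (s : seq T) (P : pred T)
    (u : T -> nat -> R[i]) :
  (forall i, P i -> vanishing (u i)) ->
  vanishing (fun I => \sum_(i <- s | P i) u i I).
Proof.
move=> h; elim: s => [|i s IH].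
  by under eq_fun do rewrite big_nil; exact: vanishing_cst0.
under eq_fun do rewrite big_cons; case: (boolP (P i)) => // Pi.
by apply: vanishingD => //; exact: h.
Qed.

Lemma vanishing_shift u k :
  vanishing u -> vanishing (fun I => u (I + k)%N).
Proof.
move=> h e /h [I0 _ hI]; exists I0 => // I /= II0; apply: hI => /=.
exact: (leq_trans II0 (leq_addr _ _)).
Qed.

End Vanishing.

(** * Vitali-type continuation of null limits *)

Section Expandable.
Variable R : realType.

(** A quantitative form of analyticity at 0: on [0, rho] the Taylor remainders
    obey Cauchy's estimates with constant M.  It passes to sums and to products
    by linear functions with explicit constants, and a common M for a family of
    functions plays the part of local boundedness in Vitali's theorem. *)
Definition expandable (rho M : R) (phi : R -> R[i]) :=
  exists b : nat -> R[i], forall n t, 0 <= t <= rho ->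
    normc (phi t - \sum_(r < n) b r * t%:C ^+ r) <= M * (t / rho) ^+ n.

Variable rho : R.
Hypothesis rho_gt0 : 0 < rho.

Lemma pow_div_fact_le_expR (x : R) n : 0 <= x -> x ^+ n / n`!%:R <= expR x.
Proof.
case: n => [|n] x0; first by rewrite expr0 fact0 divr1 -expR0 ler_expR.
by apply: le_trans (expR_ge1Dxn n x0); rewrite lerDr.
Qed.

Lemma expandable_cexp mu L : `|Re mu| <= L -> `|Im mu| <= L ->
  expandable rho (2 * expR (3 * (L * rho))) (fun t => cexp (mu * t%:C)).
Proof.
move=> reL imL; have L0 : 0 <= L by exact: le_trans reL.
exists (fun r => mu ^+ r / r`!%:R) => n t trho; have /andP[t0 _] := trho.
have [h1 h2] := exp_remainder_le n reL imL trho.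
rewrite (le_trans (normc_le_ReIm _))// (le_trans (lerD h1 h2))//.
rewrite -mulr2n -[leLHS]mulr_natl -[leRHS]mulrA ler_pM2l//.
have -> : 3 * (L * rho) = L * rho + 2 * L * rho by ring.
rewrite expRD -[leRHS]mulrA ler_pM2l ?expR_gt0//.
have -> : (2 * L) ^+ n / n`!%:R * t ^+ n =
          (2 * L * rho) ^+ n / n`!%:R * (t / rho) ^+ n.
  rewrite [in RHS](exprMn _ (2 * L) rho) expr_div_n.
  have : rho ^+ n != 0 by rewrite expf_neq0// gt_eqF.
  have : n`!%:R != 0 :> R by rewrite pnatr_eq0 -lt0n fact_gt0.
  move: (rho ^+ n) (t ^+ n) ((2 * L) ^+ n) => x y z f0 x0.
  by field; rewrite x0 f0.
apply: ler_wpM2r; first by rewrite exprn_ge0// divr_ge0// ltW.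
by apply: pow_div_fact_le_expR; rewrite mulr_ge0 ?mulr_ge0// ltW.
Qed.

Lemma le_expandable M M' phi :
  M <= M' -> expandable rho M phi -> expandable rho M' phi.
Proof.
move=> MM' [b h]; exists b => n t trho; have /andP[t0 _] := trho.
by apply: (le_trans (h n t trho)); rewrite ler_wpM2r// exprn_ge0// divr_ge0// ltW.
Qed.

Lemma expandable0 : expandable rho 0 (fun=> 0).
Proof.
exists (fun=> 0) => n t _; rewrite mul0r big1 ?subr0 ?normc0// => i _.
by rewrite mul0r.
Qed.

Lemma expandableD M M' phi psi : expandable rho M phi ->
  expandable rho M' psi -> expandable rho (M + M') (fun t => phi t + psi t).
Proof.
move=> [b hb] [c hc]; exists (fun r => b r + c r) => n t trho.
under eq_bigr do rewrite mulrDl.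
rewrite big_split/= opprD addrACA (le_trans (normcD _ _))// mulrDl lerD//.
  exact: hb.
exact: hc.
Qed.

Lemma expandableZ M c phi :
  expandable rho M phi -> expandable rho (normc c * M) (fun t => c * phi t).
Proof.
move=> [b hb]; exists (fun r => c * b r) => n t trho.
under eq_bigr do rewrite -mulrA.
by rewrite -mulr_sumr -mulrBr normcM -mulrA ler_wpM2l ?normc_ge0// hb.
Qed.

Lemma expandable_sum (T : Type) (s : seq T) (P : pred T) (M : T -> R)
    (phi : T -> R -> R[i]) :
  (forall i, P i -> expandable rho (M i) (phi i)) ->
  expandable rho (\sum_(i <- s | P i) M i)
    (fun t => \sum_(i <- s | P i) phi i t).
Proof.
move=> h; elim: s => [|i s IH].
  by rewrite big_nil; under eq_fun do rewrite big_nil; exact: expandable0.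
have -> : (fun t => \sum_(j <- i :: s | P j) phi j t) =
    fun t => if P i then phi i t + \sum_(j <- s | P j) phi j t
             else \sum_(j <- s | P j) phi j t.
  by apply/funext => t; rewrite big_cons.
rewrite big_cons; case: (boolP (P i)) => // Pi.
by apply: expandableD => //; exact: h.
Qed.

Lemma expandable_mulX M phi :
  expandable rho M phi -> expandable rho (rho * M) (fun t => t%:C * phi t).
Proof.
move=> [b hb]; exists (fun r => if r is q.+1 then b q else 0) => n t trho.
have /andP[t0 tr] := trho; case: n => [|n].
  have := hb 0%N t trho; rewrite !big_ord0 !subr0 !expr0 !mulr1 normcM => h.
  by rewrite ler_pM ?normc_ge0 ?normc_real ?ger0_norm.
rewrite big_ord_recl mul0r add0r.
under eq_bigr do rewrite /= /bump /= add1n exprS mulrCA.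
rewrite -mulr_sumr -mulrBr normcM normc_real ger0_norm//.
have -> : rho * M * (t / rho) ^+ n.+1 = t * (M * (t / rho) ^+ n).
  rewrite exprS; move: (_ ^+ n) => x; field; exact: lt0r_neq0.
by rewrite ler_wpM2l// hb.
Qed.

Lemma expandable_mul_linear M c phi : expandable rho M phi ->
  expandable rho ((normc c + rho) * M) (fun t => (c - t%:C) * phi t).
Proof.
move=> h; have h1 := expandableZ c h.
have := expandableD h1 (expandableZ (-1) (expandable_mulX h)).
rewrite normcN ComplexField.Normc.normc1 mul1r -mulrDl.
by under eq_fun do rewrite mulN1r -mulNr -mulrDl.
Qed.

Lemma expandable_mul_linearX M c k phi : expandable rho M phi ->
  expandable rho ((normc c + rho) ^+ k * M)
    (fun t => (c - t%:C) ^+ k * phi t).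
Proof.
move=> h; elim: k => [|k IH].
  by rewrite expr0 mul1r; under eq_fun do rewrite expr0 mul1r.
rewrite exprS -mulrA; under eq_fun do rewrite exprS -mulrA.
exact: expandable_mul_linear.
Qed.

(** The Taylor coefficients b I r are null in I, by induction on r: once those
    below r are, the r-th is asymptotically at most M t / rho ^ r.+1 for every
    small t > 0.  Neither convergence nor completeness is involved.  Then F I t
    is, up to a null sequence, at most M (t / rho) ^ n for every n. *)
Lemma vanishing_expandable (M d : R) (F : nat -> R -> R[i]) :
  0 < d -> (forall I, expandable rho M (F I)) ->
  (forall t, 0 <= t <= d -> vanishing (F^~ t)) ->
  forall t, 0 <= t < rho -> vanishing (F^~ t).
Proof.
move=> d0 hF hd; have [b hb] := choice hF.
have M0 : 0 <= M.
  have := hb 0%N 0%N 0; rewrite lexx ltW// => /(_ isT).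
  by rewrite expr0 mulr1; exact: le_trans (normc_ge0 _).
have hc r : vanishing (b^~ r).
  elim/ltn_ind: r => r IH e e0.
  have q0 : 0 < e * rho ^+ r.+1 / (2 * (M + 1)).
    by rewrite divr_gt0 ?mulr_gt0 ?exprn_gt0// ltr_wpDl.
  (* The third bound makes the remainder of order r.+1 at most t ^+ r * (e / 2). *)
  pose t := Num.min d (Num.min rho (e * rho ^+ r.+1 / (2 * (M + 1)))).
  have t0 : 0 < t by rewrite !lt_min d0 rho_gt0.
  have td : t <= d by rewrite ge_min lexx.
  have tr : t <= rho by rewrite !ge_min lexx orbT.
  have te : t <= e * rho ^+ r.+1 / (2 * (M + 1)) by rewrite !ge_min lexx !orbT.
  have tp : 0 < t ^+ r by rewrite exprn_gt0.
  have hr : vanishing (fun I => F I t - \sum_(q < r) b I q * t%:C ^+ q).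
    apply: vanishingB; first by apply: hd; rewrite ltW.
    apply: vanishing_sum => q _.
    by under eq_fun do rewrite mulrC; apply: vanishingZ; exact: IH.
  have e1 : 0 < t ^+ r * (e / 2) by rewrite mulr_gt0// divr_gt0.
  near=> I.
  have h1 : normc (F I t - \sum_(q < r) b I q * t%:C ^+ q) <= t ^+ r * (e / 2).
    by near: I; exact: hr.
  have h2 : normc (F I t - \sum_(q < r.+1) b I q * t%:C ^+ q) <=
      t ^+ r * (e / 2).
    apply: le_trans (hb I r.+1 t _) _; first by rewrite (ltW t0) tr.
    have -> : M * (t / rho) ^+ r.+1 = t ^+ r * (M * t / rho ^+ r.+1).
      by rewrite expr_div_n (exprS t); move: (_^-1) (t ^+ r) => x y; ring.
    rewrite ler_pM2l// ler_pdivrMr ?exprn_gt0//.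
    apply: (@le_trans _ _ ((M + 1) * t)); first by rewrite ler_wpM2r ?ltW// ltrDl.
    move: te; rewrite ler_pdivlMr; last by rewrite mulr_gt0// ltr_wpDl.
    by move: (rho ^+ r.+1) => x; lra.
  have E : normc (t%:C ^+ r) = t ^+ r.
    by rewrite normcX normc_real ger0_norm// ltW.
  rewrite -(ler_pM2l tp) -[X in X * normc _]E -normcM mulrC.
  have -> : b I r * t%:C ^+ r = (F I t - \sum_(q < r) b I q * t%:C ^+ q) -
      (F I t - \sum_(q < r.+1) b I q * t%:C ^+ q).
    by rewrite big_ord_recr/=; ring.
  by rewrite (le_trans (normcB _ _))// (le_trans (lerD h1 h2))// -mulrDr -splitr.
move=> t /andP[t0 tr] e e0.
have e2 : 0 < e / 2 by rewrite divr_gt0.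
have [n hn] : exists n, M * (t / rho) ^+ n <= e / 2.
  have x0 : 0 <= t / rho by rewrite divr_ge0// ltW.
  have x1 : `|t / rho| < 1 by rewrite ger0_norm// ltr_pdivrMr// mul1r.
  have e3 : 0 < e / 2 / (M + 1) by rewrite divr_gt0// ltr_wpDl.
  have /cvgrPdist_le/(_ _ e3)[n _ /(_ n (leqnn _))] := cvg_expr x1.
  rewrite sub0r normrN ger0_norm ?exprn_ge0//.
  rewrite ler_pdivlMr; last by rewrite ltr_wpDl.
  have : 0 <= (t / rho) ^+ n by rewrite exprn_ge0.
  by exists n; nra.
have hs : vanishing (fun I => \sum_(q < n) b I q * t%:C ^+ q).
  apply: vanishing_sum => q _.
  by under eq_fun do rewrite mulrC; apply: vanishingZ; exact: hc.
near=> I.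
have -> : F I t = (F I t - \sum_(q < n) b I q * t%:C ^+ q) +
   \sum_(q < n) b I q * t%:C ^+ q by rewrite subrK.
rewrite (le_trans (normcD _ _))// [leRHS]splitr lerD//.
  by apply: le_trans hn; apply: hb; rewrite t0 ltW.
by near: I; exact: hs.
Unshelve. all: by end_near. Qed.

End Expandable.

(** * Exponential polynomials along an arithmetic progression *)

Section ExponentialPolynomials.
Variable R : realType.

Lemma vanishing_le_inv (C : R) (u : nat -> R[i]) :
  (forall q, normc (u q) <= C / q.+1%:R) -> vanishing u.
Proof.
move=> hu e e0; have C0 : 0 <= C.
  by have := le_trans (normc_ge0 _) (hu 0%N); rewrite divr1.
have := archi_boundP (divr_ge0 C0 (ltW e0)).
set k := Num.bound _ => hk; exists k => // q /= kq.
apply: le_trans (hu q) _; rewrite ler_pdivrMr ?ltr0n// mulrC -ler_pdivrMr//.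
by rewrite (le_trans (ltW hk))// ler_nat (leq_trans kq).
Qed.

(** Applying to the shift q |-> q.+1 the polynomial whose roots are the other
    frequencies isolates one frequency, and a vector of constant modulus tends
    to 0 only if it is 0. *)
Lemma trig_sum_vanishing l (c zeta : 'I_l -> R[i]) :
  injective zeta -> (forall j, normc (zeta j) = 1) ->
  vanishing (fun q => \sum_j c j * zeta j ^+ q) -> forall j, c j = 0.
Proof.
move=> zinj z1 hv j.
pose p : {poly R[i]} := \prod_(i | i != j) ('X - (zeta i)%:P).
have pE i : p.[zeta i] = \prod_(h | h != j) (zeta i - zeta h).
  by rewrite /p horner_prod; apply: eq_bigr => h _; rewrite hornerXsubC.
have p0 i : i != j -> p.[zeta i] = 0.
  by move=> ij; rewrite pE (bigD1 i)//= subrr mul0r.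
have pj : p.[zeta j] != 0.
  rewrite pE; apply/prodf_neq0 => h hj.
  by rewrite subr_eq0; apply: contra hj => /eqP/zinj ->.
have hp : vanishing (fun q => c j * p.[zeta j] * zeta j ^+ q).
  have -> : (fun q => c j * p.[zeta j] * zeta j ^+ q) =
      (fun q => \sum_(r < size p) p`_r * \sum_i c i * zeta i ^+ (q + r)).
    apply/funext => q; under eq_bigr do rewrite mulr_sumr.
    rewrite exchange_big/= (bigD1 j)//= [X in _ + X]big1 ?addr0.
      rewrite horner_coef mulr_sumr mulr_suml; apply: eq_bigr => r _.
      by rewrite exprD; ring.
    move=> i /p0; rewrite horner_coef => e.
    under eq_bigr => r _.
      have -> : p`_r * (c i * zeta i ^+ (q + r)) =
        c i * zeta i ^+ q * (p`_r * zeta i ^+ r) by rewrite exprD; ring.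
      over.
    by rewrite -mulr_sumr e mulr0.
  apply: vanishing_sum => r _; apply: vanishingZ.
  exact: (vanishing_shift r hv).
have : vanishing (fun=> c j * p.[zeta j]).
  move=> e e0; have [I0 _ h] := hp e e0; exists I0 => // q /h.
  by rewrite normcM normcX z1 expr1n mulr1.
move=> /vanishing_cst/eqP; rewrite mulf_eq0 (negbTE pj) orbF.
by move/eqP.
Qed.

(** Dividing by the top power of w leaves the leading trigonometric sum up to
    a null sequence. *)
Lemma exp_poly_vanishing l (zeta : 'I_l -> R[i]) (w : nat -> R[i]) K
    (c : nat -> 'I_l -> R[i]) :
  injective zeta -> (forall j, normc (zeta j) = 1) ->
  (forall q, w q != 0) -> vanishing (fun q => (w q)^-1) ->
  vanishing (fun q => \sum_(k < K) (\sum_j c k j * zeta j ^+ q) * w q ^+ k) ->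
  forall k j, (k < K)%N -> c k j = 0.
Proof.
move=> zinj z1 w0 winv; elim: K => // K IH hv.
have bnd k q : normc (\sum_j c k j * zeta j ^+ q) <= \sum_j normc (c k j).
  rewrite (le_trans (normc_sum _ _ _))// ler_sum// => j _.
  by rewrite normcM normcX z1 expr1n mulr1.
have winvX k : (0 < k)%N -> vanishing (fun q => (w q)^-1 ^+ k).
  elim: k => // -[|k] IHk _; first by under eq_fun do rewrite expr1.
  move=> e e0; have e1 : 0 < Num.min e 1 by rewrite lt_min e0 /=.
  near=> q; rewrite exprS normcM -[leRHS]mul1r.
  rewrite ler_pM ?normc_ge0//; near: q; last exact: IHk.
  have [I0 _ h] := winv 1 ltr01; exists I0 => // q /h; exact.
have top : forall j, c K j = 0.
  apply: (trig_sum_vanishing zinj z1).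
  have -> : (fun q => \sum_j c K j * zeta j ^+ q) = (fun q =>
     (w q)^-1 ^+ K * (\sum_(k < K.+1) (\sum_j c k j * zeta j ^+ q) * w q ^+ k) -
     \sum_(k < K) (\sum_j c k j * zeta j ^+ q) * (w q)^-1 ^+ (K - k)).
    apply/funext => q; rewrite big_ord_recr/= mulrDr mulrCA -exprMn.
    rewrite mulVf ?w0// expr1n mulr1 mulr_sumr addrAC -[LHS]add0r; congr (_ + _).
    apply/esym/eqP; rewrite subr_eq0; apply/eqP; apply: eq_bigr => k _.
    rewrite mulrCA; congr (_ * _).
    rewrite -{1}(subnK (ltnW (ltn_ord k))) exprD -mulrA -exprMn.
    by rewrite mulVf ?w0// expr1n mulr1.
  apply: vanishingB.
    case: K {IH} hv => [|K] hv.
      by under eq_fun do rewrite expr0 mul1r.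
    move=> e e0; have e1 : 0 < Num.min e 1 by rewrite lt_min e0 /=.
    near=> q; rewrite normcM -[leRHS]mul1r.
    rewrite ler_pM ?normc_ge0//; near: q; last exact: hv.
    exact: (winvX K.+1 isT 1 ltr01).
  apply: vanishing_sum => k _.
  apply: (vanishingM_bounded (B := \sum_j normc (c k j))) => //.
  by apply: winvX; rewrite subn_gt0.
move=> k j; rewrite ltnS leq_eqVlt => /predU1P[->//|]; apply: IH.
move: hv; congr vanishing; apply/funext => q; rewrite big_ord_recr/=.
by rewrite [X in X * _]big1 ?mul0r ?addr0// => i _; rewrite top mul0r.
Unshelve. all: by end_near. Qed.

(** For s small all the phases m j * s lie where the sine is injective. *)
Lemma exists_separating_step l (m : 'I_l -> R) : injective m ->
  exists2 s : R, 0 < s & injective (fun j => cexp (0 +i* (- (m j * s)))).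
Proof.
move=> minj; pose S := 1 + \sum_j `|m j|.
have S0 : 0 < S by rewrite ltr_pwDl// sumr_ge0.
exists S^-1; first by rewrite invr_gt0.
move=> j h; rewrite /cexp /= expR0 !mul1r !sinN => -[_] /oppr_inj.
have le1 i : m i * S^-1 \in `[- (pi / 2), pi / 2].
  have : `|m i / S| <= 1.
    rewrite normrM normfV (gtr0_norm S0) ler_pdivrMr// mul1r.
    rewrite /S (bigD1 i)//= addrCA lerDl addr_ge0// sumr_ge0//.
  rewrite ler_norml in_itv/=; have := pi_ge2 R; lra.
move=> /(sin_inj (le1 _) (le1 _)) /mulIf e; apply: minj; apply: e.
by rewrite invr_neq0// gt_eqF.
Qed.

End ExponentialPolynomials.

(** * Generalized Dirichlet series with polynomial coefficients *)

Section Series.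
Variables (R : realType) (l N : nat) (m : 'I_l -> R).
Implicit Types (n : nat -> R) (a : nat -> 'I_l -> nat -> R[i]) (x y : R).

(** The exponents with real part n i contribute this block to the series
    at w = log z = x + i y. *)
Definition block n a y i x : R[i] :=
  \sum_j \sum_(k < N.+1) a i j k * cexp ((n i +i* m j) * (x +i* y))
                         * (x +i* y) ^+ k.

Definition block_weight a i : R := \sum_j \sum_(k < N.+1) normc (a i j k).

Let mm := \sum_j `|m j|.

Lemma block_weight_ge0 a i : 0 <= block_weight a i.
Proof.
by apply: sumr_ge0 => j _; apply: sumr_ge0 => k _; exact: normc_ge0.
Qed.

Lemma le_abs_sum j : `|m j| <= mm.
Proof. by rewrite /mm (bigD1 j)//= lerDl sumr_ge0. Qed.

Lemma sum_abs_ge0 : 0 <= mm. Proof. by rewrite sumr_ge0. Qed.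

Lemma normc_block_cexp_le n y i j x :
  normc (cexp ((n i +i* m j) * (x +i* y))) <= expR (n i * x) * expR (mm * `|y|).
Proof.
rewrite normc_cexp/= -expRD ler_expR lerD2l.
rewrite (le_trans (ler_norm _))// normrN normrM ler_wpM2r//.
exact: le_abs_sum.
Qed.

Lemma normc_block_le n a y i x :
  normc (block n a y i x) <=
  block_weight a i * (expR (n i * x) * expR (mm * `|y|)
                      * (1 + normc (x +i* y)) ^+ N).
Proof.
rewrite /block_weight mulr_suml (le_trans (normc_sum _ _ _))// ler_sum// => j _.
rewrite mulr_suml (le_trans (normc_sum _ _ _))// ler_sum// => k _.
rewrite !normcM normcX -mulrA ler_wpM2l ?normc_ge0// ler_pM//.
- exact: normc_ge0.
- by rewrite exprn_ge0// normc_ge0.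
- exact: normc_block_cexp_le.
apply: (@le_trans _ _ ((1 + normc (x +i* y)) ^+ k)).
  by apply: lerXn2r; rewrite ?nnegrE ?addr_ge0 ?normc_ge0// lerDr.
by apply: ler_weXn2l; rewrite ?lerDl ?normc_ge0// -ltnS.
Qed.

Lemma expandable_block n a y c rho i : 0 < rho ->
  expandable rho
    (block_weight a i * (expR (n i * c + 3 * `|n i| * rho)
       * (expR (mm * `|y|) * expR (3 * mm * rho) * 2
          * (1 + normc (c +i* y) + rho) ^+ N)))
    (fun t => block n a y i (c - t)).
Proof.
move=> rho0; rewrite /block_weight mulr_suml; apply: expandable_sum => j _.
rewrite mulr_suml; apply: expandable_sum => k _.
set wc := c +i* y; set la := n i +i* m j.
have E t : (c - t) +i* y = wc - t%:C.
  by apply/eqP; rewrite eq_complex/= subr0 !eqxx.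
have -> : (fun t => a i j k * cexp (la * ((c - t) +i* y)) * ((c - t) +i* y) ^+ k) =
  (fun t => a i j k * cexp (la * wc) * ((wc - t%:C) ^+ k * cexp (- la * t%:C))).
  apply/funext => t; rewrite E mulrBr cexpD mulNr; ring.
have rL : `|Re (- la)| <= `|n i| + mm by rewrite /= normrN lerDl sum_abs_ge0.
have iL : `|Im (- la)| <= `|n i| + mm.
  by rewrite /= normrN (le_trans (le_abs_sum j))// lerDr.
have h := expandableZ (a i j k * cexp (la * wc))
  (expandable_mul_linearX rho0 wc k (expandable_cexp rho0 rL iL)).
apply: (le_expandable rho0 _ h).
rewrite normcM -mulrA ler_wpM2l ?normc_ge0//.
have -> : expR (3 * ((`|n i| + mm) * rho)) =
    expR (3 * `|n i| * rho) * expR (3 * mm * rho).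
  by rewrite -expRD; congr expR; ring.
rewrite (expRD (n i * c)).
have h1 := normc_block_cexp_le n y i j c.
have h2 : (normc wc + rho) ^+ k <= (1 + normc wc + rho) ^+ N.
  have w0 := normc_ge0 wc.
  apply: (@le_trans _ _ ((1 + normc wc + rho) ^+ k)).
    by apply: lerXn2r; rewrite ?nnegrE ?addr_ge0 ?(ltW rho0)// lerD2r lerDr.
  apply: ler_weXn2l; last by rewrite -ltnS.
  by rewrite -addrA lerDl addr_ge0// ltW.
set e1 := expR (3 * `|n i| * rho); set e2 := expR (3 * mm * rho).
set p := (1 + normc wc + rho) ^+ N.
have -> : expR (n i * c) * e1 * (expR (mm * `|y|) * e2 * 2 * p) =
  (expR (n i * c) * expR (mm * `|y|)) * (p * (2 * (e1 * e2))) by ring.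
apply: ler_pM => //; first exact: normc_ge0.
  rewrite mulr_ge0// ?mulr_ge0 ?expR_ge0// exprn_ge0// addr_ge0 ?normc_ge0//.
  exact: ltW.
by rewrite ler_wpM2r// ?mulr_ge0 ?expR_ge0.
Qed.

(** By expandable_block, Cauchy's estimates at c with radius rho hold with a
    constant uniform in the partial sums as soon as c + 3 rho <= x1, since the
    n i are bounded below.  The radius (x1 - c0) / 3 thus serves every centre
    c <= c0, and steps of fixed length carry the vanishing of the series from
    a segment to the half-line. *)
Lemma vanishing_half_line n a y x1 B c0 d :
  {homo n : i j / (i < j)%N >-> i < j} ->
  (forall I, \sum_(i < I) block_weight a i * expR (n i * x1) <= B) ->
  c0 < x1 -> 0 < d ->
  (forall x, c0 - d <= x <= c0 ->
     vanishing (fun I => \sum_(i < I) block n a y i x)) ->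
  forall x, x <= c0 -> vanishing (fun I => \sum_(i < I) block n a y i x).
Proof.
move=> nincr hB c0x1 d0 hv.
have n0le i : n 0%N <= n i by case: i => // i; rewrite ltW// nincr.
pose rho := (x1 - c0) / 3.
have rho0 : 0 < rho by rewrite divr_gt0// subr_gt0.
have step c d' : c <= c0 -> 0 < d' ->
  (forall x, c - d' <= x <= c ->
     vanishing (fun I => \sum_(i < I) block n a y i x)) ->
  forall x, c - rho < x <= c ->
     vanishing (fun I => \sum_(i < I) block n a y i x).
  move=> cc0 d'0 h x /andP[x1' x2].
  pose D := expR (mm * `|y|) * expR (3 * mm * rho) * 2
          * (1 + normc (c +i* y) + rho) ^+ N.
  pose E := expR (`|n 0%N| * (6 * rho + (x1 - c - 3 * rho))).
  have D0 : 0 <= D.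
    rewrite mulr_ge0 ?mulr_ge0 ?expR_ge0// exprn_ge0// addr_ge0 ?normc_ge0//.
      by rewrite addr_ge0// normc_ge0.
    exact: ltW.
  have hE i : expR (n i * c + 3 * `|n i| * rho) <= E * expR (n i * x1).
    rewrite -expRD ler_expR.
    have r3 : x1 - c0 = 3 * rho by rewrite /rho; field.
    have g0 : 0 <= x1 - c - 3 * rho by lra.
    have h1 : `|n i| <= n i + 2 * `|n 0%N|.
      have := n0le i; have := ler_norm (- n 0%N); rewrite normrN => u1 u2.
      have := normr_ge0 (n 0%N).
      by case: (ger0P (n i)) => u3; lra.
    have h2 : - `|n 0%N| <= n i.
      by have := n0le i; have := ler_norm (- n 0%N); rewrite normrN; lra.
    have p1 : 0 <= rho * (n i + 2 * `|n 0%N| - `|n i|).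
      by rewrite mulr_ge0 ?(ltW rho0)// subr_ge0.
    have p2 : 0 <= (x1 - c - 3 * rho) * (n i + `|n 0%N|).
      by rewrite mulr_ge0// -lerBlDr sub0r.
    by move: p1 p2; lra.
  have hexp I : expandable rho (B * (E * D))
      (fun t => \sum_(i < I) block n a y i (c - t)).
    have h1 (i : 'I_I) : true -> expandable rho
        (block_weight a i * (expR (n i * c + 3 * `|n i| * rho) * D))
        (fun t => block n a y i (c - t)).
      by move=> _; exact: expandable_block.
    apply: (le_expandable rho0 _ (expandable_sum (index_enum _) h1)).
    apply: (@le_trans _ _ (\sum_(i < I)
        block_weight a i * expR (n i * x1) * (E * D))).
      apply: ler_sum => i _; rewrite -[leRHS]mulrA ler_wpM2l ?block_weight_ge0//.
      by rewrite [leRHS]mulrA ler_wpM2r// [leRHS]mulrC.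
    by rewrite -mulr_suml ler_wpM2r// mulr_ge0// expR_ge0.
  have := vanishing_expandable rho0 d'0 hexp.
  have -> : x = c - (c - x) by ring.
  apply; last by apply/andP; split; lra.
  by move=> t /andP[t0 td]; apply: h; apply/andP; split; lra.
(* A step of length d' out of a segment of length d' stays within rho. *)
pose d' := Num.min d (rho / 3).
have d'0 : 0 < d' by rewrite lt_min d0 divr_gt0.
have d'd : d' <= d by rewrite ge_min lexx.
have d'r : d' <= rho / 3 by rewrite ge_min lexx orbT.
have all_k k x : c0 - k.+1%:R * d' <= x <= c0 ->
    vanishing (fun I => \sum_(i < I) block n a y i x).
  elim: k x => [|k IH] x /andP[h1 h2].
    by apply: hv; apply/andP; split => //; lra.
  have [|xl] := leP (c0 - k.+1%:R * d') x; first by move=> h; apply: IH; rewrite h.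
  have kd : 0 <= k%:R * d' by rewrite mulr_ge0// ltW.
  move: h1 xl IH; rewrite -!natr1 => h1 xl IH.
  apply: (@step (c0 - k%:R * d') d') => //; first by lra.
    by move=> u /andP[u1 u2]; apply: IH; apply/andP; split; lra.
  by apply/andP; split; lra.
move=> x xc0; have := archi_boundP (divr_ge0 (_ : 0 <= c0 - x) (ltW d'0)).
rewrite subr_ge0 => /(_ xc0); set k := Num.bound _; rewrite ltr_pdivrMr// => hk.
apply: (all_k k); rewrite xc0 andbT -natr1 mulrDl; lra.
Qed.

(** Multiplied by exp (- n 0 w), the series differs from an exponential
    polynomial by a quantity that decays like exp ((n 1 - n 0) Re w) |w| ^ N as
    Re w tends to -oo. *)
Lemma leading_coefficient_eq0 n a y x1 B c0 :
  {homo n : i j / (i < j)%N >-> i < j} -> injective m ->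
  (forall I, \sum_(i < I) block_weight a i * expR (n i * x1) <= B) ->
  (forall x, x <= c0 -> vanishing (fun I => \sum_(i < I) block n a y i x)) ->
  forall j k, (k <= N)%N -> a 0%N j k = 0.
Proof.
move=> nincr minj hB hv.
have n1le i : n 1%N <= n i.+1 by case: i => // i; rewrite ltW// nincr.
(* G x bounds the sum of all later blocks, as their exponents are at least n 1
   and x lies to the left of x1. *)
pose G x := expR (mm * `|y|) * (1 + normc (x +i* y)) ^+ N *
            (expR (- n 1%N * (x1 - x)) * B).
have lead x : x <= c0 -> x <= x1 -> normc (block n a y 0 x) <= G x.
  move=> xc0 xx1.
  pose K := expR (mm * `|y|) * (1 + normc (x +i* y)) ^+ N.
  have K0 : 0 <= K.
    by rewrite mulr_ge0 ?expR_ge0// exprn_ge0// addr_ge0// normc_ge0.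
  have tail I : normc (\sum_(i < I) block n a y i.+1 x) <= G x.
    apply: (@le_trans _ _ (K * (expR (- n 1%N * (x1 - x)) *
        \sum_(i < I) block_weight a i.+1 * expR (n i.+1 * x1)))); last first.
      rewrite ler_wpM2l// ler_wpM2l ?expR_ge0//.
      apply: le_trans (hB I.+1); rewrite big_ord_recl lerDr.
      by rewrite mulr_ge0 ?expR_ge0 ?block_weight_ge0.
    rewrite (le_trans (normc_sum _ _ _))// !mulr_sumr; apply: ler_sum => i _.
    apply: le_trans (normc_block_le _ _ _ _ _) _.
    have -> : block_weight a i.+1 * (expR (n i.+1 * x) * expR (mm * `|y|) *
        (1 + normc (x +i* y)) ^+ N) =
        K * (block_weight a i.+1 * expR (n i.+1 * x)) by rewrite /K; ring.
    rewrite ler_wpM2l// mulrCA ler_wpM2l ?block_weight_ge0//.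
    rewrite -expRD ler_expR.
    have : 0 <= (n i.+1 - n 1%N) * (x1 - x) by rewrite mulr_ge0 ?subr_ge0.
    lra.
  apply/ler_addgt0Pl => e e0.
  have [I0 _ /(_ I0.+1 (leqnSn _))] := hv x xc0 e e0.
  rewrite big_ord_recl /= => h.
  have := tail I0.
  set S := \sum_(i < I0) _ => hS.
  have -> : block n a y 0 x =
      (block n a y 0 x + \sum_(i < I0) block n a y (lift ord0 i) x) - S.
    by rewrite addrK.
  by rewrite (le_trans (normcB _ _))// lerD.
have [s s0 zinj] := exists_separating_step minj.
(* Starting at or to the left of - s keeps the sample points w q off 0, with
   modulus at least q.+1 * s. *)
pose c := Num.min (Num.min c0 x1) (- s).
have cc0 : c <= c0 by rewrite !ge_min lexx.
have cx1 : c <= x1 by rewrite !ge_min lexx orbT.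
have cs : c <= - s by rewrite ge_min lexx orbT.
pose X q := c - q%:R * s.
have qs q : 0 <= q%:R * s by rewrite mulr_ge0// ltW.
have Xc q : X q <= c by rewrite /X lerBlDr lerDl.
pose w q : R[i] := X q +i* y.
have wge q : q.+1%:R * s <= normc (w q).
  have : `|X q| <= normc (w q).
    by rewrite /w /= -[leLHS]sqrtr_sqr ler_sqrt ?addr_ge0 ?sqr_ge0// lerDl sqr_ge0.
  apply: le_trans; rewrite ler0_norm; last first.
    by rewrite (le_trans (Xc q))// (le_trans cs)// oppr_le0 ltW.
  by rewrite /X -natr1; lra.
have w0 q : w q != 0.
  apply/eqP => e; have := wge q; rewrite e normc0 leNgt.
  by rewrite mulr_gt0// ltr0n.
have winv : vanishing (fun q => (w q)^-1).
  apply: (@vanishing_le_inv _ s^-1) => q.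
  rewrite ComplexField.Normc.normcV -invfM lef_pV2 ?posrE ?mulr_gt0//.
    by rewrite mulrC wge.
  exact: normc_gt0.
have w0E q : w q = w 0%N + (- (q%:R * s))%:C.
  by apply/eqP; rewrite eq_complex /= /X mul0r subr0 addr0 !eqxx.
pose zeta j : R[i] := cexp (0 +i* (- (m j * s))).
have z1 j : normc (zeta j) = 1 by rewrite /zeta normc_cexp /= expR0.
pose b k j := a 0%N j k * cexp ((0 +i* m j) * w 0%N).
have Q q : \sum_(k < N.+1) (\sum_j b k j * zeta j ^+ q) * w q ^+ k =
    cexp (- ((n 0%N)%:C * w q)) * block n a y 0 (X q).
  rewrite /block mulr_sumr; under eq_bigr do rewrite mulr_suml.
  rewrite exchange_big/=; apply: eq_bigr => j _; rewrite mulr_sumr.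
  apply: eq_bigr => k _.
  have -> : (n 0%N +i* m j) * (X q +i* y) = (n 0%N)%:C * w q +
      ((0 +i* m j) * w 0%N + (0 +i* (- (m j * s))) *+ q).
    rewrite -mulr_natr -(rmorph_nat (real_complex R)) /w /X.
    by apply/eqP; rewrite eq_complex /=; apply/andP; split; apply/eqP; ring.
  rewrite !cexpD cexpMn -/(zeta j) /b.
  have : cexp (- ((n 0%N)%:C * w q)) * cexp ((n 0%N)%:C * w q) = 1.
    by rewrite -cexpD addNr cexp0.
  move: (cexp (- _)) (cexp ((n 0%N)%:C * _)) => u v uv.
  rewrite -[LHS]mul1r -uv /w; ring.
pose kap := (n 1%N - n 0%N) * s.
have kap0 : 0 < kap by rewrite mulr_gt0// subr_gt0 nincr.
pose D := 1 + (`|c| + `|y|) + s.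
have D0 : 0 <= D by rewrite !addr_ge0// ltW.
have wle q : 1 + normc (w q) <= D * q.+1%:R.
  have h : normc (w q) <= `|c| + `|y| + q%:R * s.
    rewrite (le_trans (normc_le_ReIm _))//= /X.
    have := ler_normB c (q%:R * s); rewrite (ger0_norm (qs q)).
    by move=> ?; lra.
  have q0 : 0 <= q%:R :> R by [].
  have p1 : 0 <= q%:R * (1 + (`|c| + `|y|)) by rewrite mulr_ge0// !addr_ge0.
  by rewrite /D -natr1; move: p1 s0; move: (q%:R) q0 h => u; lra.
have hb : vanishing (fun q =>
    \sum_(k < N.+1) (\sum_j b k j * zeta j ^+ q) * w q ^+ k).
  pose A := expR (mm * `|y|) * D ^+ N * B *
     expR (- n 0%N * c - n 1%N * (x1 - c) + kap).
  have B0 : 0 <= B by apply: le_trans (hB 0%N); rewrite big_ord0.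
  have A0 : 0 <= A by rewrite !mulr_ge0 ?expR_ge0// exprn_ge0.
  apply: (@vanishing_le_inv _ (A * (N.+1`!%:R / kap ^+ N.+1))) => q.
  rewrite Q normcM normc_cexp.
  have -> : Re (- ((n 0%N)%:C * w q)) = - n 0%N * X q.
    by rewrite /= mul0r subr0 mulNr.
  have hl := lead (X q) (le_trans (Xc q) cc0) (le_trans (Xc q) cx1).
  apply: le_trans (ler_wpM2l (expR_ge0 _) hl) _.
  rewrite /G.
  have hX : 1 + normc (X q +i* y) <= D * q.+1%:R by exact: wle.
  have hXN : (1 + normc (X q +i* y)) ^+ N <= D ^+ N * q.+1%:R ^+ N.
    rewrite -exprMn; apply: lerXn2r; rewrite ?nnegrE ?addr_ge0 ?normc_ge0//.
    by rewrite mulr_ge0.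
  have E : expR (- n 0%N * X q) * expR (- n 1%N * (x1 - X q)) =
     expR (- n 0%N * c - n 1%N * (x1 - c) + kap) * expR (- (kap * q.+1%:R)).
    by rewrite -!expRD /X /kap -natr1; congr expR; ring.
  have F : q.+1%:R ^+ N * expR (- (kap * q.+1%:R)) <=
      N.+1`!%:R / kap ^+ N.+1 / q.+1%:R.
    have := pow_div_fact_le_expR N.+1 (mulr_ge0 (ltW kap0) (ler0n R q.+1)).
    rewrite expRN exprMn; set e := expR _ => he.
    have e0 : 0 < e by exact: expR_gt0.
    have q0 : 0 < q.+1%:R :> R by rewrite ltr0n.
    have k0 : 0 < kap ^+ N.+1 by rewrite exprn_gt0.
    rewrite ler_pdivrMr//.
    have -> : N.+1`!%:R / kap ^+ N.+1 / q.+1%:R * e =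
        e * N.+1`!%:R / (kap ^+ N.+1 * q.+1%:R) by rewrite invfM; ring.
    rewrite ler_pdivlMr ?mulr_gt0// mulrCA -exprSr.
    by move: he; rewrite ler_pdivrMr// ltr0n fact_gt0.
  set u := expR (- n 0%N * X q) in E *; set v := expR (- n 1%N * _) in E *.
  set u' := expR (_ + kap) in E A A0 *; set v' := expR (- (kap * _)) in E F *.
  have -> : u * (expR (mm * `|y|) * (1 + normc (X q +i* y)) ^+ N * (v * B)) =
    (expR (mm * `|y|) * B * u') * ((1 + normc (X q +i* y)) ^+ N * v').
    transitivity (expR (mm * `|y|) * (1 + normc (X q +i* y)) ^+ N * B * (u * v)).
      by ring.
    by rewrite E; ring.
  apply: (@le_trans _ _ (A * (q.+1%:R ^+ N * v'))).
    have -> : A * (q.+1%:R ^+ N * v') = (expR (mm * `|y|) * B * u') *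
      ((D ^+ N * q.+1%:R ^+ N) * v') by rewrite /A; ring.
    rewrite ler_wpM2l ?mulr_ge0 ?expR_ge0// ler_wpM2r// expR_ge0//.
  by rewrite -[leRHS]mulrA ler_wpM2l.
move=> j k kN.
have /eqP := exp_poly_vanishing zinj z1 w0 winv hb j kN.
by rewrite /b mulf_eq0 (negbTE (cexp_neq0 _)) orbF => /eqP.
Qed.

(** Once the leading block is known to vanish, the series without it satisfies
    the same hypotheses. *)
Lemma coefficients_eq0 n a y x1 B c0 d :
  {homo n : i j / (i < j)%N >-> i < j} -> injective m ->
  (forall I, \sum_(i < I) block_weight a i * expR (n i * x1) <= B) ->
  c0 < x1 -> 0 < d ->
  (forall x, c0 - d <= x <= c0 ->
     vanishing (fun I => \sum_(i < I) block n a y i x)) ->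
  forall i j k, (k <= N)%N -> a i j k = 0.
Proof.
move=> nincr minj hB c0x1 d0 /(vanishing_half_line nincr hB c0x1 d0) hv.
move=> i; elim: i n a nincr hB hv => [|i IH] n a nincr hB hv.
  exact: (leading_coefficient_eq0 nincr minj hB hv).
apply: (IH (fun i => n i.+1) (fun i => a i.+1)).
- by move=> p q pq; apply: nincr.
- move=> I; apply: le_trans (hB I.+1); rewrite big_ord_recl lerDr.
  by rewrite mulr_ge0 ?expR_ge0 ?block_weight_ge0.
move=> x /hv /(@vanishing_shift _ _ 1); congr vanishing; apply/funext => I.
rewrite addn1 big_ord_recl /= [X in X + _]big1 ?add0r// => j _.
rewrite big1// => k _.
by rewrite (leading_coefficient_eq0 nincr minj hB hv) ?mul0r// -ltnS.
Qed.

End Series.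

(** * From unordered sums to block partial sums on a ray *)

Section UnorderedSums.
Variable R : realType.

Section Blocks.
Variables (T : choiceType) (J : finType) (e : nat -> J -> T) (D : set T).
Hypothesis e_inj : forall i j i' j', e i j = e i' j' -> i = i' /\ j = j'.
Hypothesis D_range : forall x, D x <-> exists i j, x = e i j.

Let r I := [seq e (val p.1) p.2 | p <- enum {: 'I_I * J}].

Let r_uniq I : uniq (r I).
Proof.
rewrite map_inj_uniq ?enum_uniq// => -[i j] [i' j'] /= /e_inj[ii' ->].
by rewrite (val_inj ii').
Qed.

Let mem_r I x : x \in r I <-> exists i j, (i < I)%N /\ x = e i j.
Proof.
split; first by case/mapP => -[i j] _ ->; exists i, j; split => /=.
case=> i [j [iI ->]]; apply/mapP; exists (Ordinal iI, j) => //.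
by rewrite mem_enum.
Qed.

Let sum_r (V : nmodType) I (g : T -> V) :
  \sum_(x <- r I) g x = \sum_(i < I) \sum_j g (e i j).
Proof. by rewrite big_map big_enum/= pair_big. Qed.

Lemma block_sum_bounded (f : T -> R[i]) (s : R[i]) : abs_cvg_sum D f s ->
  exists B : R, forall I, \sum_(i < I) \sum_j normc (f (e i j)) <= B.
Proof.
case=> fin _.
have ge0 : (0 <= \esum_(t in D) (normc (f t))%:E)%E.
  by apply: esum_ge0 => t _; rewrite lee_fin normc_ge0.
exists (fine (\esum_(t in D) (normc (f t))%:E)%E) => I.
rewrite -(sum_r I (fun x => normc (f x))) -lee_fin fineK ?ge0_fin_numE//; apply: esum_ge.
exists [set` r I].
  split; first exact: finite_seq.
  by move=> x /mem_r[i [j [_ ->]]]; apply/D_range; exists i, j.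
by rewrite -fsbig_seq// sumEFin.
Qed.

(** The blocks below I exhaust any given finite set as I grows, and a finite
    set of indices may be enlarged to contain them without leaving the tail of
    the unordered convergence. *)
Lemma block_sum_vanishing (f : T -> R[i]) : abs_cvg_sum D f 0 ->
  vanishing (fun I => \sum_(i < I) \sum_j f (e i j)).
Proof.
case=> _ cvg eps eps0.
have e0 : 0 < eps%:C :> R[i] by rewrite ltcR.
have [A _ hA] := (@cvgrPdist_le R[i] R[i]^o _ _ totally_filter _ _).1 cvg _ e0.
have /choice[g hg] x : exists i, D x -> exists j, x = e i j.
  have [/D_range[i [j ->]]|nD] := pselect (D x); first by exists i => _; exists j.
  by exists 0%N => /nD.
exists (\max_(x <- A) g x).+1 => // I /= hI; rewrite -(sum_r I f).
pose C := seq_fset tt (r I).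
have hp : perm_eq C (r I).
  by rewrite (perm_trans (seq_fset_perm _ _))// undup_id.
have sub : (C `<=` C `|` A)%fset by exact: fsubsetUl.
have := hA (C `|` A)%fset (fsubsetUr _ _).
rewrite sub0r normrN /partial_sum -(big_seq_fsetE _ _ predT) /=.
rewrite -(big_fset_incl _ sub).
  rewrite (perm_big _ hp) /= big_seq.
  under eq_bigr => x /mem_r[i [j [_ xE]]].
    rewrite patchT; last by apply/mem_set/D_range; exists i, j.
    over.
  by rewrite -big_seq normc_def -sqr_normc_def lecR sqrtr_sqr ger0_norm ?normc_ge0.
move=> x; rewrite in_fsetU => /orP[->//|xA]; rewrite seq_fsetE => /negP nr.
rewrite /patch; case: ifPn => // /set_mem Dx; case: nr.
have [j xE] := hg _ Dx; apply/mem_r; exists (g x), j; split => //.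
by rewrite (leq_trans _ hI)// ltnS; exact: leq_bigmax_seq.
Qed.

End Blocks.

Lemma open_contains_ray (U : set R[i]^o) (z0 : R[i]) : open U -> U z0 ->
  exists2 d : R, 0 < d &
    forall h, `|h| < d -> U ((expR h)%:C * z0).
Proof.
move=> oU Uz; have := open_nbhs_nbhs (conj oU Uz).
move=> /nbhs_normP[e /= e0 he].
have er : e = (Re e)%:C.
  by case: e e0 {he} => a b; rewrite ltcE /= => /andP[/eqP -> _].
have e1 : 0 < Re e by move: e0; rewrite er ltcR.
have z1 : 0 < normc z0 + 1 by rewrite ltr_wpDl// normc_ge0.
have /cvgrPdist_lt/(_ _ (divr_gt0 e1 z1)) := @continuous_expR R 0.
move=> /nbhs_normP[d /= d0 hd]; exists d => // h hh; apply: he.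
rewrite /ball_ /=.
have -> : z0 - (expR h)%:C * z0 = (1 - expR h)%:C * z0.
  by rewrite rmorphB /= mulrBl mul1r.
rewrite normc_def -sqr_normc_def sqrtr_sqr ger0_norm ?normc_ge0// er ltcR.
rewrite normcM normc_real.
have := hd h; rewrite /ball_ /= sub0r normrN expR0 => /(_ hh).
rewrite ltr_pdivlMr// => H; apply: le_lt_trans H.
by rewrite ler_wpM2l// lerDl.
Qed.

Lemma clog_ray (z : R[i]) (h : R) : z != 0 ->
  clog ((expR h)%:C * z) = (ln (normc z) + h) +i* carg z.
Proof.
move=> z0; have nz := normc_gt0 z0.
have nE : normc ((expR h)%:C * z) = expR h * normc z.
  by rewrite normcM normc_real ger0_norm// expR_ge0.
rewrite /clog nE lnM ?posrE ?expR_gt0// expRK addrC; congr (_ +i* _).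
rewrite /carg nE.
have -> : Re ((expR h)%:C * z) = expR h * Re z.
  by case: z {z0 nz nE} => a b /=; rewrite mul0r subr0.
have -> : Im ((expR h)%:C * z) = expR h * Im z.
  by case: z {z0 nz nE} => a b /=; rewrite mul0r addr0.
rewrite pmulr_rge0 ?expR_gt0//.
have -> // : expR h * Re z / (expR h * normc z) = Re z / normc z.
have := expR_gt0 h; move: (expR h) => x x0.
by field; rewrite !gt_eqF.
Qed.

End UnorderedSums.

Theorem proposition2p1 (R : realType) (n : nat -> R) (l : nat)
    (m : 'I_l -> R) (N : nat) :
  {homo n : i j / (i < j)%N >-> i < j} ->
  injective m ->
  unique_expansion_set
    (exponent_set n m `*` [set (k%:R : R[i]) | k in [set k : nat | (k <= N)%N]]).
Proof.
move=> nincr minj a U oU [z0 Uz0] U0 hU.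
have z0n : z0 != 0 by apply/eqP => z00; apply: U0; rewrite -z00.
set D := _ `*` _ in hU *.
pose pt i (p : 'I_l * 'I_N.+1) : R[i] * R[i] := (n i +i* m p.1, (p.2)%:R).
have pt_inj i p i' p' : pt i p = pt i' p' -> i = i' /\ p = p'.
  case: p p' => [j k] [j' k'] [] /(inc_inj (le_mono nincr)) -> /minj ->.
  by move=> /eqP; rewrite eqr_nat => /eqP/val_inj ->.
have D_range x : D x <-> exists i p, x = pt i p.
  split.
    case: x => u v [/= [i _ [j _ <-]] [k /= kN <-]].
    by exists i, (j, Ordinal (kN : (k < N.+1)%N)).
  case=> i [[j k] ->]; split => /=; first by exists i => //; exists j.
  by exists (k : nat) => //=; rewrite -ltnS.
pose A i j k := a (n i +i* m j, k%:R).
have [d d0 hd] := open_contains_ray oU Uz0.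
pose x0 := ln (normc z0); pose y := carg z0.
pose f x (p : R[i] * R[i]) := a p * cexp (p.1 * (x +i* y)) * cpow (x +i* y) p.2.
have hf h : `|h| < d -> abs_cvg_sum D (f (x0 + h)) 0.
  move=> /hd /hU; congr abs_cvg_sum; apply/funext => p.
  rewrite /f /cpow clog_ray// mulf_eq0 (negbTE z0n) orbF.
  by rewrite fmorph_eq0 gt_eqF// expR_gt0.
have hv x : x0 - d / 2 <= x <= x0 ->
    vanishing (fun I => \sum_(i < I) block N m n A y i x).
  move=> /andP[h1 h2].
  have /hf : `|x - x0| < d by rewrite ltr_norml; apply/andP; split; lra.
  rewrite addrC subrK => /(block_sum_vanishing pt_inj D_range).
  congr vanishing; apply/funext => I; apply: eq_bigr => i _.
  rewrite /block pair_big; apply: eq_bigr => -[j k] _.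
  by rewrite /f /= cpow_nat.
(* The abscissa x1 must avoid w1 = 0, where the terms with k > 0 vanish and
   say nothing about their coefficients. *)
have [h [h0 hd2 x1n]] : exists h, [/\ 0 < h, h < d & x0 + h != 0].
  have [e|e] := eqVneq (x0 + d / 2) 0; last first.
    by exists (d / 2); split => //; lra.
  by exists (d / 3); split; [lra|lra|apply/eqP; lra].
pose x1 := x0 + h; pose w1 := x1 +i* y.
have w1n : 0 < normc w1.
  by apply: normc_gt0; rewrite eq_complex /= negb_and x1n.
have [B hB] : exists B : R, forall I, \sum_(i < I) \sum_p normc (f x1 (pt i p)) <= B.
  by apply: (block_sum_bounded pt_inj D_range (hf h _)); rewrite gtr0_norm.
pose mm := \sum_j `|m j|.
(* q ^+ N bounds below all the powers normc w1 ^+ k with k <= N, so that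
   absolute convergence at w1 bounds the coefficients themselves. *)
pose q := Num.min 1 (normc w1).
have q0 : 0 < q by rewrite lt_min ltr01.
have q1 : q <= 1 by rewrite ge_min lexx.
have qw : q <= normc w1 by rewrite ge_min lexx orbT.
pose kap := expR (- (mm * `|y|)) * q ^+ N.
have kap0 : 0 < kap by rewrite mulr_gt0 ?expR_gt0// exprn_gt0.
have low i j (k : 'I_N.+1) : normc (A i j k) * expR (n i * x1) * kap <=
    normc (f x1 (pt i (j, k))).
  rewrite /f /= cpow_nat !normcM normcX -/w1 -!mulrA ler_wpM2l ?normc_ge0//.
  rewrite /kap mulrA ler_pM ?mulr_ge0 ?expR_ge0 ?exprn_ge0 ?(ltW q0)//.
    rewrite normc_cexp /= -expRD ler_expR lerD2l lerN2.
    rewrite (le_trans (ler_norm _))// normrM ler_wpM2r//.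
    exact: le_abs_sum.
  apply: (@le_trans _ _ (q ^+ k)).
    by apply: ler_wiXn2l => //; [exact: ltW|rewrite -ltnS].
  by apply: lerXn2r => //; rewrite nnegrE ltW.
have hw I : \sum_(i < I) block_weight N A i * expR (n i * x1) <= B / kap.
  rewrite ler_pdivlMr//; apply: le_trans (hB I); rewrite mulr_suml.
  apply: ler_sum => i _; rewrite /block_weight pair_big !mulr_suml.
  by apply: ler_sum => -[j k] _; exact: low.
move=> p /D_range[i [[j k] ->]].
have x01 : x0 < x1 by rewrite ltrDl.
exact: (coefficients_eq0 nincr minj hw x01 (divr_gt0 d0 (ltr0n _ 2)) hv i j
  (ltn_ord k)).
Qed.
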